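(* Let $\mathcal{G}$ be a finite partial Sherk plane in which some line is incident only with thick points. Then no line of $\mathcal{G}$ has a pole; that is, for every line $\ell$ and every point $P$ not incident with $\ell$, there is at most one line incident with $P$ and perpendicular to $\ell$.
   Context: A geometry consists of points, lines, an incidence relation between points and lines, and a binary relation $\perp$ on lines. Two lines intersect if some point is incident with both. A partial Sherk plane is a geometry satisfying: (A* ) two distinct points are incident with at most one line; (B1) $\ell\perp m$ implies $m\perp\ell$; (B2) perpendicular lines intersect in at least one point; (B3) for any point $P$ and line $\ell$ there is at least one line through $P$ perpendicular to $\ell$; (B4) for any line $\ell$ and point $P$ on $\ell$ there is a unique line through $P$ perpendicular to $\ell$; (B5) there exist lines $x,y,z$ with $x\perp y$, $x\not\perp z$, $y\not\perp z$, and $x,y,z$ not all through a common point. It is finite if it has finitely many points. A point is thick if it is incident with at least three lines. A point $P$ not on a line $\ell$ is a pole of $\ell$ if there is more than one line through $P$ perpendicular to $\ell$. *)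

(* Defs.v *)
From mathcomp Require Import all_boot.
From mathcomp Require Import classical_sets cardinality.
Set Implicit Arguments.
Unset Strict Implicit.
Unset Printing Implicit Defensive.

Local Open Scope classical_set_scope.

(* Points and lines are two independent sorts: a line is not assumed to be
   determined by the set of points incident with it. *)
Record geometry := Geometry {
  point : Type;
  line : Type;
  incident : point -> line -> Prop;
  perp : line -> line -> Prop }.

Definition intersect (G : geometry) (l m : line G) : Prop :=
  exists P : point G, incident P l /\ incident P m.

Record partial_Sherk_plane (G : geometry) : Prop := PartialSherkPlane {
  axiomAstar : forall (P Q : point G) (l m : line G), P <> Q ->
    incident P l -> incident Q l -> incident P m -> incident Q m -> l = m;
  axiomB1 : forall l m : line G, perp l m -> perp m l;
  axiomB2 : forall l m : line G, perp l m -> intersect l m;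
  axiomB3 : forall (P : point G) (l : line G),
    exists m : line G, incident P m /\ perp m l;
  axiomB4 : forall (l : line G) (P : point G), incident P l ->
    exists! m : line G, incident P m /\ perp m l;
  axiomB5 : exists x y z : line G,
    [/\ perp x y, ~ perp x z, ~ perp y z &
        ~ (exists P : point G, [/\ incident P x, incident P y & incident P z])]
}.

(* Only the points are required to be finite in number, not the lines. *)
Definition finite_geometry (G : geometry) : Prop :=
  finite_set [set: point G].

Definition thick (G : geometry) (P : point G) : Prop :=
  exists l m n : line G,
    [/\ l <> m, l <> n & m <> n] /\
    [/\ incident P l, incident P m & incident P n].

Definition is_pole (G : geometry) (P : point G) (l : line G) : Prop :=
  ~ incident P l /\
  exists m n : line G,
    [/\ m <> n, incident P m, perp m l, incident P n & perp n l].

(* Main.v *)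
From mathcomp Require Import finmap boolp classical_sets cardinality.
From mathcomp Require Import all_boot all_algebra zify ring.
Require Import Defs.

(* Call the number of lines through a point its degree.  A non-perpendicular
   pair of lines has the same number of points (drop perpendiculars), and P is
   a pole of l only if all lines through P are perpendicular to l.  A line of
   thick points then forces all lines to have the same size.  Suppose some pole
   exists.  Counting the pairs l _|_ k _|_ m shows that disjoint lines have the
   same perpendiculars, and every point turns out to be a pole of some line.
   Comparing perpendiculars between the pencils of two collinear points shows
   that all degrees agree, so that, up to parallelism, the perpendicularity
   graph is regular of degree s and any two vertices have t common neighbours.
   As in the friendship theorem and in Baer's theorem on polarities, this is
   impossible for an irreflexive relation: modulo a prime p dividing s - t the
   adjacency matrix A satisfies (A - J)^2 = 0, while A - J has trace -s <> 0. *)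

Set Implicit Arguments.
Unset Strict Implicit.
Unset Printing Implicit Defensive.
Import GRing.Theory.

(** * Double counting, transversals and a trace lemma *)

Lemma double_count (S T : finType) (R : S -> T -> bool) (A : {set S}) (B : {set T}) :
  \sum_(x in A) #|[set y in B | R x y]| = \sum_(y in B) #|[set x in A | R x y]|.
Proof.
under eq_bigr do rewrite -sum1dep_card.
under [RHS]eq_bigr do rewrite -sum1dep_card.
rewrite (exchange_big_dep (mem B)) /=; last by move=> x y _ /andP[].
by apply: eq_bigr => y yB; apply: eq_bigl => x; rewrite yB.
Qed.

Lemma card_gt2_neq (T : finType) (x y : T) (A : {set T}) : 2 < #|A| ->
  exists z, [/\ z \in A, z != x & z != y].
Proof.
move=> cardA; have /subsetPn[z zA] : ~~ (A \subset [set x; y]).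
  apply: contraL cardA => /subset_leq_card le; rewrite -leqNgt (leq_trans le) //.
  by rewrite cards2; case: (x != y).
by rewrite !inE negb_or => /andP[zx zy]; exists z.
Qed.

Lemma transversal_ex (T : finType) (U : eqType) (f : T -> U) :
  exists R : {set T}, forall x, #|[set y in R | f y == f x]| = 1.
Proof.
pose rep x := odflt x [pick y | f y == f x].
have frep x : f (rep x) = f x.
  by rewrite /rep; case: pickP => [y /eqP //|/(_ x)]; rewrite eqxx.
have repE x y : f x = f y -> rep x = rep y.
  move=> xy; rewrite /rep (@eq_pick _ _ [pred z | f z == f y]); last by move=> z /=; rewrite xy.
  by case: pickP => // /(_ y); rewrite /= eqxx.
exists [set x | rep x == x] => x; apply/eqP/cards1P; exists (rep x).
apply/setP => y; rewrite !inE; apply/andP/eqP => [[/eqP ry /eqP yx]|->].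
  by rewrite -ry; apply: repE.
by rewrite (repE _ x) // frep !eqxx.
Qed.

(** Take a rank factorisation [B = U *m V]. Cancelling [U] and [V] in [B *m B = 0] by one-sided
    inverses gives [V *m U = 0], whose trace is that of [B]. *)
Lemma sqr0_trace (T : finType) (F : fieldType) (f : T -> T -> F) :
  (forall x y, \sum_z f x z * f z y = 0)%R -> (\sum_x f x x = 0)%R.
Proof.
move=> f2; pose B : 'M_#|T| := (\matrix_(i, j) f (enum_val i) (enum_val j))%R.
have sumE (g : T -> F) : (\sum_x g x = \sum_(i < #|T|) g (enum_val i))%R.
  by rewrite -(big_enum_val (A := T)); apply: eq_bigl.
have trB : (\sum_x f x x = \tr B)%R.
  by rewrite sumE; apply: eq_bigr => i _; rewrite mxE.
have BB : (B *m B = 0)%R.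
  apply/matrixP => i j; rewrite !mxE -[RHS](f2 (enum_val i) (enum_val j)) sumE.
  by apply: eq_bigr => k _; rewrite !mxE.
have [r [U [V [/row_fullP[C CU] /row_freeP[D VD] BE]]]] :
    exists r (U : 'M_(#|T|, r)) (V : 'M_(r, #|T|)),
      [/\ row_full U, row_free V & B = U *m V]%R.
  exists (\rank B), (col_base B), (row_base B).
  by rewrite col_base_full row_base_free mulmx_base.
have VU : (V *m U = C *m (B *m B) *m D)%R.
  by rewrite BE !mulmxA CU mul1mx -!mulmxA VD mulmx1.
by rewrite trB BE mxtrace_mulC VU BB mulmx0 mul0mx mxtrace0.
Qed.

(** * Perpendiculars and poles in a finite plane *)

Section FinitePlane.

Variables (P L : finType) (inc : P -> L -> bool) (perp : rel L).
Implicit Types (X Y Z Q : P) (k l m n : L).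

Definition points_on l := [set X | inc X l].
Definition pencil X := [set l | inc X l].
Definition perps l := [set m | perp m l].
(* The lines having X as a pole. *)
Definition polars X := [set l | pencil X \subset perps l].
Definition parallel_class l := [set m | perps m == perps l].
Definition num_perps l X := #|pencil X :&: perps l|.

Hypothesis Astar : forall X Y l m, X != Y ->
  inc X l -> inc Y l -> inc X m -> inc Y m -> l = m.
Hypothesis perpC : symmetric perp.
Hypothesis perpp : irreflexive perp.
Hypothesis perp_meet : forall l m, perp l m -> exists2 X, inc X l & inc X m.
Hypothesis perp_ex : forall X l, exists2 m, inc X m & perp m l.
Hypothesis perp_uniq : forall X l m n,
  inc X l -> inc X m -> perp m l -> inc X n -> perp n l -> m = n.
Variable l0 : L.
Hypothesis l0_thick : forall X, inc X l0 -> 2 < #|pencil X|.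

Lemma card_points_capI l m : l != m -> #|points_on l :&: points_on m| <= 1.
Proof.
move=> lm; rewrite leqNgt; apply/negP => /card_gt1P[X [Y []]].
rewrite !inE => /andP[Xl Xm] /andP[Yl Ym] XY.
by move/eqP: lm; apply; apply: (Astar XY).
Qed.

Lemma meet_uniq l m X Y : l != m -> inc X l -> inc X m -> inc Y l -> inc Y m -> X = Y.
Proof.
move=> lm Xl Xm Yl Ym; apply/eqP/negPn/negP => XY.
by move/eqP: lm; apply; apply: (Astar XY).
Qed.

Lemma perp_neq l m : perp l m -> l != m.
Proof. by move=> lm; apply/eqP => E; rewrite E perpp in lm. Qed.

Lemma num_perps_gt0 l X : 0 < num_perps l X.
Proof.
have [m Xm ml] := perp_ex X l.
by rewrite card_gt0; apply/set0Pn; exists m; rewrite !inE Xm.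
Qed.

Lemma num_perps_on l X : inc X l -> num_perps l X = 1.
Proof.
move=> Xl; apply/eqP; rewrite eqn_leq num_perps_gt0 andbT leqNgt.
apply/negP => /card_gt1P[m [n []]]; rewrite !inE => /andP[Xm ml] /andP[Xn nl].
by move/eqP; apply; apply: (perp_uniq Xl).
Qed.

Lemma sum_num_perps l m :
  \sum_(X in points_on m) num_perps l X = \sum_(k in perps l) #|points_on m :&: points_on k|.
Proof.
have := double_count inc (points_on m) (perps l).
under eq_bigr do rewrite setIdE setIC.
by under [in RHS]eq_bigr do rewrite setIdE.
Qed.

(** In [sum_num_perps] with [m = l], all summands on both sides equal 1. *)
Lemma card_perps l : #|perps l| = #|points_on l|.
Proof.
have := sum_num_perps l l.
under eq_bigr => X; first by rewrite inE => Xl; rewrite num_perps_on //; over.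
under [in RHS]eq_bigr => k.
  rewrite inE => kl.
  have -> : #|points_on l :&: points_on k| = 1.
    apply/eqP; rewrite eqn_leq card_points_capI 1?eq_sym ?(perp_neq kl) //=.
    have [X Xk Xl] := perp_meet kl.
    by rewrite card_gt0; apply/set0Pn; exists X; rewrite !inE Xk Xl.
  over.
by rewrite !sum1_card.
Qed.

Lemma sum_num_perps_le l m : ~~ perp m l ->
  \sum_(X in points_on m) num_perps l X <= #|points_on l|.
Proof.
move=> ml; rewrite sum_num_perps -card_perps -sum1_card; apply: leq_sum => k.
rewrite inE => kl; apply: card_points_capI.
by apply: contraNneq ml => ->.
Qed.

Lemma card_points_le l m : ~~ perp m l -> #|points_on m| <= #|points_on l|.
Proof.
move=> ml; apply: leq_trans (sum_num_perps_le ml); rewrite -sum1_card.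
by apply: leq_sum => X _; exact: num_perps_gt0.
Qed.

Lemma card_points_nperp l m : ~~ perp m l -> #|points_on m| = #|points_on l|.
Proof.
by move=> ml; apply/eqP; rewrite eqn_leq !card_points_le // perpC.
Qed.

(* Distinct points of m have distinct perpendiculars to l, which are only as
   numerous as the points of m. *)
Lemma num_perps_nperp l m X : ~~ perp m l -> inc X m -> num_perps l X = 1.
Proof.
move=> ml Xm; apply/eqP; rewrite eqn_leq num_perps_gt0 andbT.
have := sum_num_perps_le ml; rewrite -(card_points_nperp ml).
rewrite (bigD1 X) ?inE //= -sum1_card [X in _ <= X](bigD1 X) ?inE //=.
have : \sum_(i in points_on m | i != X) 1 <= \sum_(i in points_on m | i != X) num_perps l i.
  by apply: leq_sum => Y _; exact: num_perps_gt0.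
move=> h1 h2; rewrite -(leq_add2r (\sum_(i in points_on m | i != X) 1)).
by apply: leq_trans h2; rewrite leq_add2l.
Qed.

(** A line through [X] not perpendicular to [l] would leave [X] only one perpendicular to [l]. *)
Lemma polars_of_two l m n X : m != n -> inc X m -> inc X n -> perp m l -> perp n l ->
  l \in polars X.
Proof.
move=> mn Xm Xn ml nl; rewrite inE; apply/subsetP => k; rewrite !inE => Xk.
apply/negPn/negP => kl; have := num_perps_nperp kl Xk; apply/eqP.
rewrite neq_ltn; apply/orP; right; apply/card_gt1P; exists m, n.
by rewrite !inE Xm ml Xn nl.
Qed.

Lemma polarsP l X k : l \in polars X -> inc X k -> perp k l.
Proof. by rewrite inE => /subsetP h Xk; have := h k; rewrite !inE; apply. Qed.

Lemma pencil_gt1 X : 1 < #|pencil X|.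
Proof.
have [l Xl _] := perp_ex X l0; have [m Xm ml] := perp_ex X l.
by apply/card_gt1P; exists m, l; rewrite !inE (perp_neq ml).
Qed.

Lemma num_perpsE l X : num_perps l X = 1 + (l \in polars X) * #|pencil X|.-1.
Proof.
case: (boolP (l \in polars X)) => lX.
  rewrite /num_perps (setIidPl _); last by rewrite inE in lX.
  by have := pencil_gt1 X; lia.
rewrite mul0n; apply/eqP; rewrite eqn_leq num_perps_gt0 andbT leqNgt.
apply: contra lX => /card_gt1P[m [n []]]; rewrite !inE => /andP[Xm ml] /andP[Xn nl] mn.
by have := polars_of_two mn Xm Xn ml nl; rewrite inE.
Qed.

(** * All lines have the same size *)

Definition line_size := #|points_on l0|.

(** If [l] and [m] are perpendicular, a third line through [X] is perpendicular to neither, so it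
    has the size of both. *)
Lemma card_points_thick X l m : 2 < #|pencil X| -> inc X l -> inc X m ->
  #|points_on l| = #|points_on m|.
Proof.
move=> thickX Xl Xm; case: (boolP (perp l m)) => lm; last exact: card_points_nperp.
have [n Xn [nl nm]] : exists2 n, inc X n & n != l /\ n != m.
  have [n] := card_gt2_neq l m thickX.
  by case; rewrite inE => Xn nl nm; exists n.
rewrite -(@card_points_nperp l n) 1?(@card_points_nperp m n) //.
  apply/negP => n_m; move/eqP: nl; apply; exact: (perp_uniq Xm).
apply/negP => n_l; move/eqP: nm; apply; apply: (perp_uniq Xl) => //; by rewrite perpC.
Qed.

Lemma card_points_const l : #|points_on l| = line_size.
Proof.
case: (boolP (perp l l0)) => ll0; last exact: card_points_nperp.
have [X Xl Xl0] := perp_meet ll0.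
exact: (card_points_thick (l0_thick Xl0)).
Qed.

Lemma card_perps_const l : #|perps l| = line_size.
Proof. by rewrite card_perps card_points_const. Qed.

(** Count the pairs of a line through [X] and a perpendicular to it: each line serves as the
    perpendicular once, or [#|pencil X|] times if it is in [polars X]. *)
Lemma point_count X : line_size * #|pencil X| = #|L| + #|polars X| * #|pencil X|.-1.
Proof.
have := double_count (fun l m => perp m l) (pencil X) setT.
under eq_bigr => l _.
  rewrite (_ : [set m in setT | perp m l] = perps l); last by apply/setP=> m; rewrite !inE.
  rewrite card_perps_const; over.
rewrite sum_nat_const mulnC => ->.
under eq_bigr => l _.
  rewrite (_ : #|_| = num_perps l X); last first.
    by apply: eq_card => m; rewrite !inE perpC.
  rewrite num_perpsE; over.
rewrite big_split sum_nat_const muln1 /= cardsT -big_distrl /=; congr (_ + _ * _).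
by rewrite -sum1_card [RHS]big_mkcond; apply: eq_big => l; rewrite ?inE //; case: (_ \subset _).
Qed.

Lemma line_size_lt_lines : line_size < #|L|.
Proof.
rewrite -(card_perps_const l0) -cardsT; apply: proper_card; rewrite properT.
by apply/eqP => /setP/(_ l0); rewrite !inE perpp.
Qed.

(** * Parallelism in the presence of a pole *)

Variables (X0 : P) (l1 m1 n1 : L).
Hypotheses (m1n1 : m1 != n1) (X0m1 : inc X0 m1) (X0n1 : inc X0 n1).
Hypotheses (m1l1 : perp m1 l1) (n1l1 : perp n1 l1).

Lemma l1_polar : l1 \in polars X0.
Proof. exact: (polars_of_two m1n1). Qed.

Lemma perps_neq0 l : perps l != set0.
Proof. by have [m _ ml] := perp_ex X0 l; apply/set0Pn; exists m; rewrite inE. Qed.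

Lemma points_neq0 l : exists X, inc X l.
Proof. by have [m _ ml] := perp_ex X0 l; have [X _] := perp_meet ml; exists X. Qed.

Lemma line_size_gt0 : 0 < line_size.
Proof. by rewrite -(card_perps_const l0) card_gt0 perps_neq0. Qed.

Definition disjoint_lines l := [set m | points_on l :&: points_on m == set0].

Lemma sum_lines l (g : L -> nat) :
  \sum_m g m = g l + \sum_(X in points_on l) \sum_(m in pencil X | m != l) g m
                   + \sum_(m in disjoint_lines l) g m.
Proof.
rewrite (exchange_big_dep (predC1 l)) /=; last by move=> X m _ /andP[].
rewrite (bigD1 l) //= -addnA; congr (_ + _).
rewrite (bigID (mem (disjoint_lines l))) /= addnC.
congr (_ + _); last first.
  apply: eq_bigl => m; case: eqP => //= ->; rewrite inE; apply/esym/set0Pn.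
  by have [X Xl] := points_neq0 l; exists X; rewrite !inE Xl.
rewrite [RHS](bigID (mem (disjoint_lines l))) /=.
rewrite [X in _ = X + _]big1 ?add0n => [|m /andP[ml]]; last first.
  rewrite inE => /eqP E.
  apply: big_pred0 => X; apply/negP => /andP[Xl /andP[Xm _]].
  by have := in_set0 X; rewrite -E !inE in Xl Xm *; rewrite Xl Xm.
apply: eq_bigr => m /andP[ml]; rewrite inE => /set0Pn[X]; rewrite !inE => /andP[Xl Xm].
rewrite (big_pred1 X) // => Y; rewrite /= !inE ml andbT.
apply/andP/eqP => [[Yl Ym]|-> //].
by apply: (meet_uniq ml).
Qed.

Lemma perps_meet X l m : l != m -> inc X l -> inc X m -> perps l :&: perps m = polars X.
Proof.
move=> lm Xl Xm; apply/setP => k; rewrite in_setI; apply/andP/idP => [|kX].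
  rewrite 2!in_set => -[kl km].
  by apply: (polars_of_two lm Xl Xm); rewrite perpC.
by rewrite !inE perpC (polarsP kX) // perpC (polarsP kX).
Qed.

Lemma sum_perps l : \sum_m #|perps l :&: perps m| = line_size * line_size.
Proof.
have := double_count (fun k m => perp m k) (perps l) setT.
under eq_bigr => k _.
  rewrite (_ : [set m in setT | perp m k] = perps k); last by apply/setP=> m; rewrite !inE.
  rewrite card_perps_const; over.
rewrite sum_nat_const card_perps_const => ->.
rewrite [RHS]big_mkcond /=; apply: eq_bigr => m _.
by rewrite inE; apply: eq_card => k; rewrite !inE [perp m k]perpC.
Qed.

Lemma card_pencilD1 X l : inc X l ->
  #|[set m | (m \in pencil X) && (m != l)]| = #|pencil X|.-1.
Proof.
move=> Xl; rewrite (cardsD1 l (pencil X)) inE Xl /=.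
by apply: eq_card => m; rewrite !inE andbC.
Qed.

Lemma card_lines l :
  #|L| = 1 + \sum_(X in points_on l) #|pencil X|.-1
           + #|disjoint_lines l|.
Proof.
have -> : #|L| = \sum_(m : L) 1 by rewrite sum1_card.
rewrite (sum_lines l) sum1_card; congr (_ + _ + _).
apply: eq_bigr => X; rewrite inE => Xl.
by rewrite sum1dep_card card_pencilD1.
Qed.

(* Row l of A^2 sums to line_size ^ 2, and the intersecting pairs leave exactly
   line_size for each disjoint m on average, which is the largest possible value. *)
Lemma disjoint_perps l m : points_on l :&: points_on m = set0 -> perps l = perps m.
Proof.
move=> lm.
have /eqP sumE : \sum_(m in disjoint_lines l) #|perps l :&: perps m| =
    \sum_(m in disjoint_lines l) line_size.
  have := sum_perps l; rewrite (sum_lines l) setIid card_perps_const.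
  have -> : \sum_(X in points_on l) \sum_(k in pencil X | k != l) #|perps l :&: perps k|
     = \sum_(X in points_on l) #|polars X| * #|pencil X|.-1.
    apply: eq_bigr => X; rewrite inE => Xl.
    rewrite (eq_bigr (fun=> #|polars X|)) => [|k /andP[]]; last first.
      by rewrite inE => Xk kl; rewrite (@perps_meet X) // eq_sym.
    by rewrite sum_nat_cond_const mulnC card_pencilD1.
  have : \sum_(X in points_on l) line_size * #|pencil X| =
         \sum_(X in points_on l) (#|L| + #|polars X| * #|pencil X|.-1).
    by apply: eq_bigr => X _; rewrite point_count.
  have -> : \sum_(X in points_on l) line_size * #|pencil X| =
       \sum_(X in points_on l) (line_size + line_size * #|pencil X|.-1).
    by apply: eq_bigr => X _; have := pencil_gt1 X; case: #|_| => // r _; rewrite mulnS.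
  rewrite !big_split /= !sum_nat_const card_points_const -big_distrr /=.
  rewrite (card_lines l) -/(disjoint_lines l); lia.
have leif k : k \in disjoint_lines l ->
    #|perps l :&: perps k| <= line_size ?= iff (#|perps l :&: perps k| == line_size).
  by move=> _; split=> //; rewrite -(card_perps_const l) subset_leq_card ?subsetIl.
have [_] := leqif_sum leif; rewrite sumE => /esym/forall_inP/(_ m).
rewrite inE lm eqxx => /(_ isT)/eqP cardlm.
have E1 : perps l :&: perps m = perps l.
  by apply/eqP; rewrite eqEcard subsetIl card_perps_const cardlm /=.
have E2 : perps l :&: perps m = perps m.
  by apply/eqP; rewrite eqEcard subsetIr card_perps_const cardlm /=.
by rewrite -E1 E2.
Qed.

(** If [l] and [m] were distinct, their [line_size] perpendiculars would be the polars of [X], and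
    [point_count] would give [#|L| = line_size]. *)
Lemma parallel_disjoint X l m : perps l = perps m -> inc X l -> inc X m -> l = m.
Proof.
move=> E Xl Xm; apply/eqP/negPn/negP => lm.
have := perps_meet lm Xl Xm; rewrite -E setIid => E2.
have := point_count X; rewrite -E2 card_perps_const.
have := line_size_lt_lines; have := pencil_gt1 X; have := line_size_gt0; nia.
Qed.

(** * Every line has a pole and every point is one *)

Lemma pole_ex l : exists X, l \in polars X.
Proof.
(* Counting points on the perpendiculars to [m] shows that the excess contributed by the poles of
   [m] is the same for all [m]; for [l1] it is positive. *)
have cnt m : line_size * line_size = #|P| + \sum_X (m \in polars X) * #|pencil X|.-1.
  have := double_count (fun k X => inc X k) (perps m) setT.
  under eq_bigr => k _.
    rewrite (_ : [set X in setT | inc X k] = points_on k); last by apply/setP=> X; rewrite !inE.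
    rewrite card_points_const; over.
  rewrite sum_nat_const card_perps_const => ->.
  under eq_bigr => X _.
    rewrite (_ : #|_| = num_perps m X); last first.
      by apply: eq_card => k; rewrite !inE andbC.
    rewrite num_perpsE; over.
  rewrite big_split sum_nat_const muln1 /= cardsT; congr (_ + _).
  by apply: eq_bigl => X; rewrite inE.
have lt : #|P| < line_size * line_size.
  rewrite (cnt l1) (bigD1 X0) //= l1_polar; have := pencil_gt1 X0; lia.
apply/existsP; apply: contraLR lt => /existsPn h.
by rewrite (cnt l) big1 ?addn0 ?ltnn // => X _; rewrite (negPf (h X)).
Qed.

(** From a pole [Y] of a line [k1] through [X], drop a perpendicular [h] to a second line [k2]
    through [X]; it is also perpendicular to [k1]. *)
Lemma polars_gt0 X : 0 < #|polars X|.
Proof.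
have /card_gt1P[k1 [k2 []]] := pencil_gt1 X; rewrite !inE => X1 X2 k12.
have [Y k1Y] := pole_ex k1; have [h Yh hk2] := perp_ex Y k2.
rewrite card_gt0; apply/set0Pn; exists h; apply: (polars_of_two k12) => //.
  by rewrite perpC (polarsP k1Y).
by rewrite perpC.
Qed.

(** * Equality of all degrees *)

Lemma sum_num_perps_pencil X Y :
  \sum_(k in pencil X) num_perps k Y = #|pencil X| + #|pencil X :&: polars Y| * #|pencil Y|.-1.
Proof.
under eq_bigr do rewrite num_perpsE.
rewrite big_split sum_nat_const muln1 /= -big_distrl /=; congr (_ + _ * _).
rewrite -sum1_card big_mkcond [RHS]big_mkcond; apply: eq_bigr => k _ /=.
by rewrite in_setI; case: (k \in pencil X); case: (k \in polars Y).
Qed.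

(** Since [k] passes through [Y], a polar of [Y] through [X] is the perpendicular to [k] at [X]. *)
Lemma card_pencil_polars_le1 X Y k : inc X k -> inc Y k -> #|pencil X :&: polars Y| <= 1.
Proof.
move=> Xk Yk; rewrite leqNgt; apply/negP => /card_gt1P[p [q []]].
rewrite !in_setI => /andP[Xp pY] /andP[Xq qY] /eqP; apply.
rewrite !inE in Xp Xq.
by apply: (perp_uniq Xk) => //; rewrite perpC (polarsP (X := Y)).
Qed.

(** Count the perpendicular pairs between the two pencils in both ways. If no line through [X] were
    a polar of [Y], either the degrees would agree or [Y] would have degree 1. *)
Lemma pole_of_pencil_neq X Y k : inc X k -> inc Y k -> #|pencil X| != #|pencil Y| ->
  exists2 h, inc X h & h \in polars Y.
Proof.
move=> Xk Yk XY; suff /set0Pn[h] : pencil X :&: polars Y != set0.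
  by rewrite in_setI [_ \in pencil X]inE => /andP[]; exists h.
rewrite -card_gt0 lt0n; apply: contra XY => /eqP a0.
have := card_pencil_polars_le1 Yk Xk.
have : \sum_(h in pencil X) num_perps h Y = \sum_(h in pencil Y) num_perps h X.
  have := double_count (fun l m => perp m l) (pencil X) (pencil Y).
  under eq_bigr => h _.
    rewrite (_ : [set m in pencil Y | perp m h] = pencil Y :&: perps h).
      over.
    by apply/setP => m; rewrite !inE.
  rewrite -/(num_perps _ _) => ->; apply: eq_bigr => h _.
  by apply: eq_card => m; rewrite !inE perpC.
rewrite !sum_num_perps_pencil a0; have := pencil_gt1 X; have := pencil_gt1 Y.
by case: #|_ :&: _| => [|[|a]] //; lia.
Qed.

(* h is the perpendicular to k at X; Z runs over the points of h collinear with Y. *)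
Lemma pencil_card_transfer X Y Z k h j :
    inc X k -> inc Y k -> #|pencil X| != #|pencil Y| -> 2 < #|pencil Y| ->
    inc X h -> h \in polars Y -> inc Y j -> inc Z j -> inc Z h ->
  #|pencil Z| = #|pencil X|.
Proof.
move=> Xk Yk XY thickY Xh hY Yj Zj Zh.
have kh : perp k h := polarsP hY Yk.
(* Otherwise some line through [X] is a polar of [W]; being perpendicular to [h] at [X] it is [k],
   so [i] is perpendicular to [k]. *)
have nperp i W : inc Y i -> inc W i -> inc W h -> ~~ perp i k -> #|pencil W| = #|pencil X|.
  move=> Yi Wi Wh ik; apply/eqP/negPn/negP => WX; rewrite eq_sym in WX.
  have [g Xg gW] := pole_of_pencil_neq Xh Wh WX.
  suff gk : g = k by move: ik; rewrite -gk (polarsP gW).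
  by apply: (perp_uniq Xh) => //; rewrite perpC (polarsP gW).
have [jk|] := boolP (perp j k); last exact: nperp.
(* Here [j] is the perpendicular to [k] at [Y], so a third line [i] falls under [nperp]. *)
have [i Yi [ik ij]] : exists2 i, inc Y i & i != k /\ i != j.
  have [i] := card_gt2_neq k j thickY.
  by case; rewrite inE => Yi ik ij; exists i.
have nik : ~~ perp i k.
  by apply/negP => ik'; move/eqP: ij; apply; apply: (perp_uniq Yk).
have ih : perp i h := polarsP hY Yi.
have [W Wi Wh] := perp_meet ih.
rewrite -(nperp i W) //; apply/eqP/negPn/negP => ZW; rewrite eq_sym in ZW.
(* The polar of [Z] through [W] must be [i], and then [i] and [k] are both perpendicular to [j] at
   [Y]. *)
have [g Wg gZ] := pole_of_pencil_neq Wh Zh ZW.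
have gi : g = i by apply: (perp_uniq Wh) => //; rewrite perpC (polarsP gZ).
have ji : perp j i by rewrite -gi (polarsP gZ).
by move/eqP: ik; apply; apply: (perp_uniq Yj) => //; rewrite perpC.
Qed.

(* Apply the transfer lemma to both sides of the triangle formed by k and its
   perpendiculars at X and Y: the third vertex would have both degrees. *)
Lemma pencil_card_thick X Y k : inc X k -> inc Y k ->
  2 < #|pencil X| -> 2 < #|pencil Y| -> #|pencil X| = #|pencil Y|.
Proof.
move=> Xk Yk thickX thickY; apply/eqP/negPn/negP => XY.
have YX : #|pencil Y| != #|pencil X| by rewrite eq_sym.
have [h Xh hY] := pole_of_pencil_neq Xk Yk XY.
have [g Yg gX] := pole_of_pencil_neq Yk Xk YX.
have [Z Zg Zh] := perp_meet (polarsP hY Yg).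
case/eqP: (XY).
rewrite -(pencil_card_transfer Xk Yk XY thickY Xh hY Yg Zg Zh).
exact: (pencil_card_transfer Yk Xk YX thickX Yg gX Xh Zh Zg).
Qed.

Lemma all_thick X : 2 < #|pencil X|.
Proof.
rewrite ltnNge; apply/negP => thinX.
have Xl0 : ~~ inc X l0.
  by apply/negP => /l0_thick; rewrite ltnNge thinX.
(* Two lines through [X] disjoint from [l0] would have the same perpendiculars as [l0], hence
   coincide. *)
have [k Xk [Q Qk Ql0]] : exists2 k, inc X k & exists2 Q, inc Q k & inc Q l0.
  have /card_gt1P[k1 [k2 []]] := pencil_gt1 X; rewrite !inE => X1 X2 k12.
  have meet k : points_on k :&: points_on l0 != set0 -> exists2 Q, inc Q k & inc Q l0.
    by case/set0Pn => Q; rewrite !inE => /andP[]; exists Q.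
  have [/disjoint_perps E1|/meet] := eqVneq (points_on k1 :&: points_on l0) set0; last by exists k1.
  have [/disjoint_perps E2|/meet] := eqVneq (points_on k2 :&: points_on l0) set0; last by exists k2.
  by move/eqP: k12; case; apply: (parallel_disjoint _ X1 X2); rewrite E1.
have thickQ := l0_thick Ql0.
have XQ : #|pencil X| != #|pencil Q| by rewrite neq_ltn (leq_ltn_trans thinX).
have [h Xh hQ] := pole_of_pencil_neq Xk Qk XQ.
(* Transfer along [l0] gives this point the degree of [X], although it is thick. *)
have [Y Yl0 Yh] := perp_meet (polarsP hQ Ql0).
have := l0_thick Yl0.
by rewrite (pencil_card_transfer Xk Qk XQ thickQ Xh hQ Ql0 Yl0 Yh) ltnNge thinX.
Qed.

Lemma pencil_card_const X Y : #|pencil X| = #|pencil Y|.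
Proof.
(* A path of two lines through [Q] joins [X] to [Y]. *)
have [k Xk _] := perp_ex X l0; have [n Yn nk] := perp_ex Y k.
have [Q Qn Qk] := perp_meet nk.
apply: (@etrans _ _ #|pencil Q|).
  by apply: (pencil_card_thick Xk Qk); apply: all_thick.
by apply: (pencil_card_thick Qn Yn); apply: all_thick.
Qed.

Lemma polars_card_const X Y : #|polars X| = #|polars Y|.
Proof.
have := point_count X; rewrite (pencil_card_const X Y) point_count => /addnI/eqP.
rewrite eqn_pmul2r; first by move/eqP.
by have := pencil_gt1 Y; lia.
Qed.

(** * The regular graph on parallel classes *)

Lemma card_parallel_class l : #|L| = #|parallel_class l| + line_size * #|pencil X0|.-1.
Proof.
have -> : parallel_class l = l |: disjoint_lines l.
  apply/setP => m; rewrite !inE; apply/eqP/orP => [ml|[/eqP-> //|/eqP/disjoint_perps//]].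
  have [lm|/set0Pn[X]] := eqVneq (points_on l :&: points_on m) set0; first by right.
  by rewrite !inE => /andP[Xl Xm]; left; rewrite (parallel_disjoint ml Xm Xl).
rewrite cardsU1 inE setIid (_ : points_on l != set0); last first.
  by have [X Xl] := points_neq0 l; apply/set0Pn; exists X; rewrite inE.
rewrite (card_lines l) (eq_bigr (fun=> #|pencil X0|.-1)) => [|X _]; last first.
  by rewrite (pencil_card_const X X0).
by rewrite sum_nat_const card_points_const; lia.
Qed.

Lemma finite_no_pole : False.
Proof.
(* R represents the parallel classes; w is their common size. *)
have [R Rrep] := transversal_ex perps.
set w := #|parallel_class l0|.
have wE l : #|parallel_class l| = w.
  by have := card_parallel_class l; rewrite (card_parallel_class l0) => /addIn.
have w_gt0 : 0 < w by rewrite card_gt0; apply/set0Pn; exists l0; rewrite inE.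
(* A set closed under parallelism is a union of classes of size [w]. *)
have cardR (S : {set L}) : (forall l m, perps l = perps m -> l \in S -> m \in S) ->
    #|S| = w * #|S :&: R|.
  move=> clS; have := double_count (fun l m => perps m == perps l) S (S :&: R).
  under eq_bigr => l lS.
    rewrite (_ : [set m in _ | _] = [set m in R | perps m == perps l]).
      rewrite Rrep; over.
    apply/setP => m; rewrite !inE; case: eqP => [ml|]; last by rewrite !andbF.
    by rewrite (clS l m).
  rewrite sum1_card => ->; rewrite mulnC -sum_nat_const.
  apply: eq_bigr => m; rewrite inE => /andP[mS _]; rewrite -(wE m).
  apply: eq_card => l; rewrite !inE eq_sym; case: eqP => [ml|]; last by rewrite !andbF.
  by rewrite andbT; apply/(clS m l).
have clN l m n : perps m = perps n -> m \in perps l -> n \in perps l.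
  move=> mn; rewrite !inE => ml; have : l \in perps n by rewrite -mn inE perpC.
  by rewrite inE perpC.
have clU X l m : perps l = perps m -> l \in polars X -> m \in polars X.
  by move=> lm; rewrite !inE lm.
set b := #|R|; set s' := #|perps l0 :&: R|; set t' := #|polars X0 :&: R|.
set r := #|pencil X0|.-1.
have bE : #|L| = w * b by rewrite -cardsT cardR ?setTI // => *; rewrite inE.
have sE l : #|perps l :&: R| = s'.
  have := cardR _ (clN l); have := cardR _ (clN l0).
  by rewrite !card_perps_const => -> /eqP; rewrite eqn_pmul2l // => /eqP.
have tE X : #|polars X :&: R| = t'.
  have := cardR _ (clU X); have := cardR _ (clU X0).
  by rewrite (polars_card_const X X0) => -> /eqP; rewrite eqn_pmul2l // => /eqP.
have t'_gt0 : 0 < t'.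
  by have := polars_gt0 X0; rewrite (cardR _ (clU X0)) muln_gt0 => /andP[].
have r_gt1 : 1 < r by have := all_thick X0; rewrite /r; lia.
have b_s : b = 1 + s' * r.
  have := card_parallel_class l0; rewrite -/w -/r bE -(card_perps_const l0) (cardR _ (clN l0)) -/s'.
  by rewrite -mulnA -[X in X + _]muln1 -mulnDr => /eqP; rewrite eqn_pmul2l // => /eqP.
have s_t : s' = 1 + t' * r.
  have := point_count X0; rewrite -/r bE -(card_perps_const l0).
  rewrite (cardR _ (clN l0)) -/s' (cardR _ (clU X0)) -/t'.
  have -> : #|pencil X0| = r.+1 by rewrite prednK // (ltnW (pencil_gt1 X0)).
  rewrite -!mulnA -mulnDr => /eqP; rewrite eqn_pmul2l // => /eqP; nia.
(* As [s' - t' = 1 + t' * (r - 1)] is at least 2, it has a prime divisor, modulo which [b], [s'] and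
   [t'] agree. *)
pose p := pdiv (s' - t').
have p_pr : prime p by apply: pdiv_prime; nia.
have p_dvd : p %| s' - t' := pdiv_dvd _.
have charF := pchar_Fp p_pr.
have t's' : (t'%:R = s'%:R :> 'F_p)%R.
  have := p_dvd; rewrite (dvdn_pcharf charF) natrB; last by nia.
  by rewrite subr_eq0 => /eqP.
have bs' : (b%:R = s'%:R :> 'F_p)%R.
  have -> : b = s' + (s' - t') * r by nia.
  have := p_dvd; rewrite (dvdn_pcharf charF) => /eqP E.
  by rewrite natrD natrM E mul0r addr0.
(* This is [A - J] with the columns outside [R] set to zero, so that products and the trace run over
   one line per class. *)
pose f l m : 'F_p := (((perp l m)%:R - 1) * (m \in R)%:R)%R.
have sumR (S : {set L}) : (\sum_(n in R) (n \in S)%:R = #|S :&: R|%:R :> 'F_p)%R.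
  rewrite -natr_sum -big_mkcondr /= sum1_card; congr (_%:R)%R.
  by apply: eq_card => n; rewrite in_setI andbC.
(* Parallel lines share [s'] neighbours in [R], distinct meeting lines [t']. *)
have common l m : (#|perps l :&: perps m :&: R|%:R = s'%:R :> 'F_p)%R.
  have [/disjoint_perps->|/set0Pn[X]] := eqVneq (points_on l :&: points_on m) set0.
    by rewrite setIid sE.
  rewrite !inE => /andP[Xl Xm]; have [<-|lm] := eqVneq l m; first by rewrite setIid sE.
  by rewrite (perps_meet lm Xl Xm) tE.
have f2 l m : (\sum_n f l n * f n m = 0)%R.
  transitivity ((\sum_(n in R) ((n \in perps l :&: perps m)%:R - (n \in perps l)%:R
     - (n \in perps m)%:R + 1)) * (m \in R)%:R : 'F_p)%R.
    rewrite mulr_suml [RHS]big_mkcond; apply: eq_bigr => n _; rewrite /f [perp l n]perpC.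
    rewrite in_setI !inE; case: (n \in R); last by rewrite mulr0 mul0r.
    by case: (perp n l); case: (perp n m); rewrite /=; ring.
  rewrite big_split !sumrB !sumR common !sE /= sumr_const bs' -/b.
  by rewrite subrr sub0r addNr mul0r.
(* The trace is [-b], so [p] divides [b], hence also [s'] and [t'], against [s' = 1 + t' * r]. *)
have := sqr0_trace f2.
rewrite (eq_bigr (fun l => - (l \in R)%:R)%R) => [|l _]; last first.
  by rewrite /f perpp sub0r mulN1r.
rewrite sumrN => /eqP; rewrite oppr_eq0 -natr_sum -big_mkcond sum1_card -/b bs'.
rewrite -(dvdn_pcharf charF) => p_s'.
have p_t' : p %| t' by rewrite (dvdn_pcharf charF) t's' -(dvdn_pcharf charF).
move: p_s'; rewrite s_t dvdn_addl ?dvdn_mulr // dvdn1 => /eqP p1.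
by rewrite p1 in p_pr.
Qed.

End FinitePlane.

(** * Passage to finite types *)

Lemma finType_bij (T : Type) (F : finType) (f : T -> F) : injective f ->
  exists (U : finType) (g : U -> T), bijective g.
Proof.
move=> f_inj; pose U := {y : F | `[< exists x, f x = y >]}.
have pre (y : U) : exists x, f x = val y by case: y => y /= /asboolP.
have im x : `[< exists x', f x' = f x >] by apply/asboolP; exists x.
exists U, (fun y => projT1 (cid (pre y))), (fun x => exist _ (f x) (im x)) => [y|x].
  by apply: val_inj; case: cid => x /= ->.
by case: cid => x' /= /f_inj.
Qed.

Lemma finite_set_finType (T : Type) : finite_set [set: T]%classic ->
  exists (U : finType) (g : U -> T), bijective g.
Proof.
elim/Pchoice: T => T; case/finite_fsetP => X TX.
have inX (x : T) : x \in X.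
  by have : [set: T]%classic x by []; rewrite TX.
apply: (@finType_bij T X (fun x => FSetSub (inX x))) => x y /(congr1 val).
by [].
Qed.

(** * Nondegeneracy consequences of the axioms *)

Section PartialSherkPlane.

Variable G : geometry.
Hypothesis hG : partial_Sherk_plane G.
Implicit Types (X Y Q : point G) (l m n : line G).

Lemma perp_feet_eq Q l m n : incident Q l -> incident Q m -> perp m l ->
  incident Q n -> perp n l -> m = n.
Proof.
move=> Ql Qm ml Qn nl; have [k [_ kuniq]] := axiomB4 hG Ql.
by rewrite -(kuniq m) // -(kuniq n).
Qed.

Lemma incident_ex l : exists X, incident X l.
Proof.
have [x [_ [_ [/(axiomB2 hG)[X _] _ _ _]]]] := axiomB5 hG.
have [m [_ /(axiomB2 hG)[Y [_ Yl]]]] := axiomB3 hG X l.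
by exists Y.
Qed.

(** The perpendicular to [l] from any point must meet [l] in [X], so it is [m]. *)
Lemma one_point_perp X l m : (forall Y, incident Y l -> Y = X) -> incident X l ->
  incident X m -> perp m l -> forall Y, incident Y m.
Proof.
move=> lX Xl Xm ml Y; have [n [Yn nl]] := axiomB3 hG Y l.
have [Z [Zn Zl]] := axiomB2 hG nl; rewrite (lX Z Zl) in Zn.
by rewrite (perp_feet_eq Xl Xm ml Zn nl).
Qed.

(** If [l] contained all points, every other line would have a single point and, by
    [one_point_perp], be perpendicular to [l]. Then [x] and [l] would be two perpendiculars to [y]
    at [Q]. *)
Lemma point_off_line l : exists X, ~ incident X l.
Proof.
apply: contrapT => /forallNP allP; have {}allP X : incident X l by apply: contrapT.
have [x [y [z [xy xz yz nc]]]] := axiomB5 hG.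
have [Q [Qx Qy]] := axiomB2 hG xy.
have Qz : ~ incident Q z by move=> Qz; apply: nc; exists Q.
have [Z Zz] := incident_ex z.
have QZ : Q <> Z by move=> E; rewrite E in Qz.
have perpl m : m <> l -> perp m l.
  move=> ml; have [X Xm] := incident_ex m.
  have mX Y : incident Y m -> Y = X.
    move=> Ym; apply: contrapT => YX; apply: ml.
    exact: (axiomAstar hG YX).
  have [n [Xn nm]] := axiomB3 hG X m.
  have alln := one_point_perp mX Xm Xn nm.
  by rewrite -(axiomAstar hG QZ (alln Q) (alln Z) (allP Q) (allP Z)); apply: (axiomB1 hG).
have zl : perp z l by apply: perpl => E; apply: Qz; rewrite E.
have xl : x <> l by move=> E; apply: xz; rewrite E; apply: (axiomB1 hG).
have yl : y <> l by move=> E; apply: yz; rewrite E; apply: (axiomB1 hG).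
apply: xl; apply: (perp_feet_eq Qy) => //.
by apply: (axiomB1 hG); apply: perpl.
Qed.

(** Otherwise every perpendicular to [l] would be [l] itself, by uniqueness at a common point, and
    [l] would contain all points. *)
Lemma not_perp_self l : ~ perp l l.
Proof.
move=> ll; have [X Xl] := point_off_line l; apply: Xl.
have [n [Xn nl]] := axiomB3 hG X l.
have [Z [Zn Zl]] := axiomB2 hG nl.
by rewrite (perp_feet_eq Zl Zl ll Zn nl).
Qed.

Lemma two_points l : exists X Y, [/\ X <> Y, incident X l & incident Y l].
Proof.
have [X Xl] := incident_ex l; apply: contrapT => h.
have lX Y : incident Y l -> Y = X.
  by move=> Yl; apply: contrapT => YX; apply: h; exists Y, X.
have [m [Xm ml]] := axiomB3 hG X l.
by have [Y] := point_off_line m; apply; apply: (one_point_perp lX Xl Xm ml).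
Qed.

End PartialSherkPlane.

Theorem theorem3p22 (G : geometry) (hG : partial_Sherk_plane G)
  (finG : finite_geometry G)
  (thick_line : exists l : line G, forall P : point G, incident P l -> thick P) :
  forall (l : line G) (P : point G), ~ is_pole P l.
Proof.
move=> l P [_ [m [n [mn Pm ml Pn nl]]]].
have [PT [gP [gP' gPK gP'K]]] := finite_set_finType finG.
(* A line has two points, so its point set determines it; thus there are finitely many lines. *)
have pts_inj : injective (fun k : line G => [set X : PT | `[< incident (gP X) k >]]).
  move=> k1 k2 /setP E; have [X [Y [XY Xk Yk]]] := two_points hG k1.
  have k12 Z : incident Z k1 -> incident Z k2.
    by have := E (gP' Z); rewrite !inE gP'K => + /asboolP => -> /asboolP.
  exact: (axiomAstar hG XY Xk Yk (k12 _ Xk) (k12 _ Yk)).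
have [LT [gL [gL' gLK gL'K]]] := finType_bij pts_inj.
pose inc X k := `[< incident (gP X) (gL k) >].
pose prp j k := `[< perp (gL j) (gL k) >].
have [l0 l0_thick] := thick_line.
apply: (@finite_no_pole PT LT inc prp _ _ _ _ _ _ (gL' l0) _ (gP' P) (gL' l) (gL' m) (gL' n)).
- move=> X Y j k XY /asboolP Xj /asboolP Yj /asboolP Xk /asboolP Yk.
  apply: (can_inj gLK); apply: (axiomAstar hG _ Xj Yj Xk Yk).
  by move/(can_inj gPK); apply/eqP.
- by move=> j k; apply/asboolP/asboolP; apply: (axiomB1 hG).
- by move=> j; apply/asboolP; apply: not_perp_self.
- move=> j k /asboolP/(axiomB2 hG)[X [Xj Xk]].
  by exists (gP' X); apply/asboolP; rewrite gP'K.
- move=> X k; have [j [Xj jk]] := axiomB3 hG (gP X) (gL k).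
  by exists (gL' j); apply/asboolP; rewrite gL'K.
- move=> X i j k /asboolP Xi /asboolP Xj /asboolP ji /asboolP Xk /asboolP ki.
  by apply: (can_inj gLK); apply: (perp_feet_eq hG Xi).
- move=> X /asboolP; rewrite gL'K => /l0_thick[i [j [k [[ij ik jk] [Xi Xj Xk]]]]].
  apply/card_gt2P; exists (gL' i), (gL' j), (gL' k); rewrite !inE.
  split; split; try by apply/asboolP; rewrite gL'K.
  + by apply/eqP => /(can_inj gL'K).
  + by apply/eqP => /(can_inj gL'K).
  + by apply/eqP => /(can_inj gL'K)/esym.
- by apply/eqP => /(can_inj gL'K).
- by apply/asboolP; rewrite gP'K gL'K.
- by apply/asboolP; rewrite gP'K gL'K.
- by apply/asboolP; rewrite !gL'K.
- by apply/asboolP; rewrite !gL'K.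
Qed.
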